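(* Assume the Erdős girth conjecture: for every positive integer $k$ and every sufficiently large positive integer $n$ there exists an $n$-vertex graph with girth $>2k$ and $\Omega(n^{1+1/k})$ edges. Then for all positive integers $k,h$ and sufficiently large $n$, there are $n$-node $K_h$-minor-free graphs $G$ for which every $(2k-1)$-spanner $H$ of $G$ has sparsity and lightness $$\Omega\left(h^{\frac{2}{k+1}}\right).$$
   Context: For a (possibly weighted) graph $G$ and a real $t\ge 1$, a $t$-spanner of $G$ is a subgraph $H\subseteq G$ on the same vertex set with $\mathrm{dist}_H(u,v)\le t\cdot \mathrm{dist}_G(u,v)$ for all vertices $u,v$. The sparsity of $H$ is $|E(H)|/n$, where $n$ is the number of vertices of $G$. The lightness of $H$ is $w(H)/w(\mathrm{MST}(G))$, where $w(\cdot)$ denotes total edge weight and $\mathrm{MST}(G)$ is a minimum spanning tree (forest) of $G$. The girth of a graph is the length of its shortest cycle.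
   Formalization: The claim is stated for h ≥ 3 instead of all positive h: no nonempty graph is K_1-minor-free, and K_2-minor-free graphs have no edges (sparsity 0), so the bound fails for h = 1, 2. The Ω-constants may depend on k only. *)

(* Defs.v *)
From HB Require Import structures.
Set Warnings "-redundant-canonical-projection".
From mathcomp Require Export all_boot all_order all_algebra.
From mathcomp Require Export all_classical all_reals all_analysis.

Set Implicit Arguments.
Unset Strict Implicit.
Unset Printing Implicit Defensive.

Import Order.TTheory GRing.Theory Num.Theory.

Local Open Scope classical_set_scope.
Local Open Scope ring_scope.

(* Finite simple graphs on the vertex type T: an edge is a two-element set. *)
Record graph (T : finType) := Graph {
  edges :> {set {set T}};
  _ : [forall e in edges, #|e| == 2%N]
}.

HB.instance Definition _ (T : finType) := [isSub for @edges T].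
HB.instance Definition _ (T : finType) := [Finite of graph T by <:].

Definition adj (T : finType) (G : graph T) : rel T :=
  fun x y => [set x; y]%SET \in edges G.

Definition is_cycle (T : finType) (G : graph T) (c : seq T) : Prop :=
  ucycle (adj G) c /\ (3 <= size c)%N.

(* The girth of an acyclic graph is +oo. *)
Definition girth (R : realType) (T : finType) (G : graph T) : \bar R :=
  ereal_inf [set (size c)%:R%:E | c in is_cycle G].

Section Weighted.
Variables (R : realType) (T : finType).
Implicit Types (w : {set T} -> R) (G H F : graph T).

Definition weight w G : R := \sum_(e in edges G) w e.

(* The walk u :: p traverses the edges {u, p_0}, {p_0, p_1}, ... *)
Definition walk_weight w (u : T) (p : seq T) : R :=
  \sum_(e <- pairmap (fun x y => [set x; y]%SET) u p) w e.

(* The value is +oo when v is not reachable from u. *)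
Definition dist w G (u v : T) : \bar R :=
  ereal_inf [set (walk_weight w u p)%:E |
               p in [set p | path (adj G) u p /\ last u p = v]].

Definition is_spanner (t : R) w G H : Prop :=
  edges H \subset edges G /\
  forall u v : T, (dist w H u v <= t%:E * dist w G u v)%E.

Definition sparsity H : R := #|edges H|%:R / #|T|%:R.

(* F is a maximal forest of G: one spanning tree per connected component. *)
Definition is_spanning_forest G F : Prop :=
  [/\ edges F \subset edges G,
      forall c, ~ is_cycle F c &
      forall x y, connect (adj F) x y = connect (adj G) x y].

Definition is_mst w G F : Prop :=
  is_spanning_forest G F /\
  forall F', is_spanning_forest G F' -> weight w F <= weight w F'.

(* A chosen minimum spanning forest; the default G of xget is never used,
   since the finite graph G has at least one spanning forest. *)
Definition mst w G : graph T := xget G [set F | is_mst w G F].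

Definition lightness w G H : R := weight w H / weight w (mst w G).

End Weighted.

Definition unit_weight (R : realType) (T : finType) : {set T} -> R := fun=> 1.

Definition connected_in (T : finType) (G : graph T) (A : {set T}) : Prop :=
  forall x y, x \in A -> y \in A ->
    connect (fun a b => [&& a \in A, b \in A & adj G a b]) x y.

(* Minors are given by their branch sets B. *)
Definition is_minor (S T : finType) (X : graph S) (G : graph T) : Prop :=
  exists B : S -> {set T},
    [/\ forall s, B s != finset.set0,
        forall s, connected_in G (B s),
        forall s s', s != s' -> (B s :&: B s')%SET = finset.set0 &
        forall s s', adj X s s' ->
          exists x y, [/\ x \in B s, y \in B s' & adj G x y]].

Lemma complete_subproof (h : nat) :
  [forall e in [set e : {set 'I_h} | #|e| == 2%N]%SET, #|e| == 2%N].
Proof. by apply/forall_inP => e; rewrite inE. Qed.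

Definition complete (h : nat) : graph 'I_h := Graph (complete_subproof h).

Definition K_minor_free (h : nat) (T : finType) (G : graph T) : Prop :=
  ~ is_minor (complete h) G.

(* The constant implicit in Omega may depend on k. *)
Definition erdos_girth_conjecture (R : realType) : Prop :=
  forall k : nat, (0 < k)%N ->
  exists2 c : R, 0 < c &
  exists n0 : nat, forall n : nat, (0 < n)%N -> (n0 <= n)%N ->
  exists G : graph 'I_n,
    ((2 * k)%:R%:E < girth R G)%E /\
    c * n%:R `^ (1 + 1 / k%:R) <= #|edges G|%:R.

(* Main.v *)
(** Take a graph of girth > 2k on about h^(2k/(k+1)) vertices with about h^2
    edges, and delete edges until fewer than 'C(h, 2) remain. A disjoint union
    of copies of it is K_h-minor-free, since a K_h minor would lie in one copy
    and use 'C(h, 2) of its edges. By the girth condition its only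
    (2k-1)-spanner is the graph itself, and its density is of order
    h^2 / h^(2k/(k+1)) = h^(2/(k+1)). With unit weights a minimum spanning
    forest has at most n edges, so the lightness is at least the sparsity. *)

Require Import Defs.
From mathcomp Require Import all_boot all_order all_algebra.
From mathcomp Require Import all_classical all_reals all_analysis.
From mathcomp Require Import ring lra.
Set Implicit Arguments.
Unset Strict Implicit.
Unset Printing Implicit Defensive.

Import Order.TTheory GRing.Theory Num.Theory.
Local Open Scope ring_scope.

(** * Subgraphs, cycles and spanning forests *)

Section Graphs.
Variable T : finType.
Implicit Types (G F H : graph T) (A : {set {set T}}).

Lemma restrict_subproof G A : [forall e in (edges G :&: A)%SET, #|e| == 2%N].
Proof.
apply/forall_inP => e; rewrite inE => /andP[eG _].
by case: G eG => E /= /forall_inP; apply.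
Qed.

Definition restrict G A : graph T := Graph (restrict_subproof G A).

Lemma card_edge G (e : {set T}) : e \in edges G -> #|e| = 2%N.
Proof. by case: G => E /= /forall_inP EP /EP/eqP. Qed.

Lemma adj_sym G : symmetric (adj G).
Proof. by move=> x y; rewrite /adj finset.setUC. Qed.

Lemma adj_subset F G : edges F \subset edges G -> subrel (adj F) (adj G).
Proof. by move=> /fintype.subsetP FG x y; apply: FG. Qed.

Lemma adj_connect_sym G : connect_sym (adj G).
Proof. exact/sym_connect_sym/adj_sym. Qed.

Lemma is_cycle_subset F G c :
  edges F \subset edges G -> is_cycle F c -> is_cycle G c.
Proof.
move=> /adj_subset FG [/andP[cF Uc] c3]; split => //.
by apply/andP; split => //; apply: sub_cycle cF.
Qed.

Lemma set2_eqP (x y a b : T) : [set a; b]%SET = [set x; y]%SET ->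
  (a = x /\ b = y) \/ (a = y /\ b = x).
Proof.
move=> E.
have : a \in [set x; y]%SET by rewrite -E set21.
have : b \in [set x; y]%SET by rewrite -E set22.
have : x \in [set a; b]%SET by rewrite E set21.
have : y \in [set a; b]%SET by rewrite E set22.
rewrite !inE => ya xa /orP[]/eqP bE /orP[]/eqP aE; move: ya xa; rewrite bE aE.
- by rewrite !orbb => /eqP ->; left.
- by right.
- by left.
- by rewrite !orbb => _ /eqP ->; left.
Qed.

(** The rest of the cycle still joins the ends of the removed edge, so every walk can be
    rerouted. *)
Lemma connect_remove_cycle_edge G c : is_cycle G c ->
  exists2 e, e \in edges G &
    connect (adj (restrict G (~: [set e])%SET)) =2 connect (adj G).
Proof.
case: c => [|x [|z p']] [/andP[cG Uc] //]; rewrite /= !ltnS => p'0.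
have yp : last z p' \in p'.
  by case: p' p'0 {cG Uc} => //= t p _; apply: mem_last.
set y := last z p' in yp *; move: cG; rewrite /= rcons_path.
move=> /and3P[xz zp yx].
exists [set y; x]%SET => // u v.
set F := restrict _ _.
have FE a b : adj F a b = adj G a b && ([set a; b]%SET != [set y; x]%SET).
  by rewrite /adj /= !inE.
move: Uc => /= /and3P[xNp zNp _].
have xzF : adj F x z.
  rewrite FE xz; apply/eqP => /set2_eqP[[xy _]|[_ zy]].
    by rewrite xy inE yp orbT in xNp.
  by rewrite zy yp in zNp.
(* This part of the cycle avoids [x], so it cannot use the removed edge. *)
have zpF : path (adj F) z p'.
  apply: (@sub_in_path _ (fun a => a != x) (adj G)) zp; last first.
    by apply/allP => a ap; apply: contraNneq xNp => <-.
  move=> a b ax bx ab; rewrite FE ab; apply/eqP => /set2_eqP[[_ E]|[E _]].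
    by rewrite -topredE /= E eqxx in bx.
  by rewrite -topredE /= E eqxx in ax.
have xyF : connect (adj F) x y.
  by apply: connect_trans (connect1 xzF) _; apply/connectP; exists p'.
apply/idP/idP.
  by apply: connect_sub => a b; rewrite FE => /andP[/connect1].
apply: connect_sub => a b ab.
have [/set2_eqP[[-> ->]|[-> ->]]|ne] := eqVneq [set a; b]%SET [set y; x]%SET.
- by rewrite adj_connect_sym.
- by [].
- by apply: connect1; rewrite FE ab.
Qed.

(* Breadth-first search: each vertex is joined to a neighbour that is closer
   to the root of its component. *)
Lemma sparse_connected_subgraph G : exists F,
  [/\ edges F \subset edges G, connect (adj F) =2 connect (adj G) &
      (#|edges F| <= #|T|)%N].
Proof.
pose rt := fingraph.root (adj G).
pose walk x m := `[< exists p, [/\ path (adj G) x p, last x p = rt x & size p = m] >].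
have walk_ex x : exists m, walk x m.
  have /connectP[p pG pE] := connect_root (adj G) x.
  by exists (size p); apply/asboolP; exists p.
pose d x := ex_minn (walk_ex x).
(* The second vertex of a shortest walk to the root serves as [par x]; the remainder of that walk
   bounds its distance. *)
have /choice[par parP] x : exists y, x = rt x \/
    [/\ adj G x y, rt y = rt x & (d y < d x)%N].
  rewrite /d; case: ex_minnP => m /asboolP[[|y p] [/=]].
    by move=> _ xE _ _; exists x; left.
  move=> /andP[xy yp] lastE <- _; exists y; right.
  have yx : rt y = rt x.
    by apply/esym/fingraph.rootP; [apply: adj_connect_sym|apply: connect1].
  split=> //; case: ex_minnP => m' _; rewrite ltnS; apply.
  by apply/asboolP; exists p; rewrite yx.
(* One set per vertex bounds the size by [#|T|]. Nothing is known about [par] at a root; [restrict]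
   discards the set there unless it is an edge of [G]. *)
pose F := restrict G [set [set x; par x]%SET | x in T]%SET.
have FG : edges F \subset edges G by apply: finset.subsetIl.
have toroot x : connect (adj F) x (rt x).
  have [m] := ubnP (d x); elim: m x => // m IH x; rewrite ltnS => dx.
  case: (parP x) => [<- //|[xy <- dxy]].
  apply: connect_trans (IH _ (leq_trans dxy dx)).
  apply: connect1; rewrite /adj /= inE -/(adj G x (par x)) xy /=.
  exact: imset_f.
exists F; split => //.
- move=> x y; apply/idP/idP.
    by apply: connect_sub => a b /(adj_subset FG)/connect1.
  move=> /(fingraph.rootP (adj_connect_sym G)) xy.
  apply: connect_trans (toroot x) _.
  by rewrite adj_connect_sym /rt xy; apply: toroot.
- apply: leq_trans (subset_leq_card (finset.subsetIr _ _)) _.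
  by rewrite (leq_trans (leq_imset_card _ _)).
Qed.

(** Among the subgraphs with the connectivity of [G], one with fewest edges is acyclic, since an
    edge of a cycle could be deleted. Comparison with the sparse subgraph bounds its size. *)
Lemma spanning_forest_exists G : exists2 F,
  is_spanning_forest G F & (#|edges F| <= #|T|)%N.
Proof.
have [P [PG PE cP]] := sparse_connected_subgraph G.
pose good F := (edges F \subset edges G) &&
  [forall x, forall y, connect (adj F) x y == connect (adj G) x y].
have goodP : good P.
  by rewrite /good PG; apply/forallP => x; apply/forallP => y; rewrite PE.
have [F /andP[FG /'forall_forallP FE] Fmin] :=
  @arg_minnP _ P good (fun F : graph T => #|edges F|) goodP.
exists F; last exact: leq_trans (Fmin _ goodP) cP.
split => // [c /connect_remove_cycle_edge[e eF eE]|x y]; last exact/eqP.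
have := Fmin (restrict F (~: [set e])%SET).
have /[swap] /[apply] : good (restrict F (~: [set e])%SET).
  rewrite /good (fintype.subset_trans (finset.subsetIl _ _) FG) /=.
  by apply/'forall_forallP => x y; rewrite eE.
by rewrite leqNgt /= -finset.setDE (cardsD1 e (edges F)) eF ltnS leqnn.
Qed.

End Graphs.

(** * Unit weights: lightness against sparsity, and spanners of graphs of high girth *)

Section UnitWeight.
Variables (R : realType) (T : finType).
Implicit Types (G F H : graph T).
Let w := @unit_weight R T.

Lemma weight_unit G : weight w G = #|edges G|%:R.
Proof. by rewrite /weight sumr_const. Qed.

Lemma walk_weight_unit u p : walk_weight w u p = (size p)%:R.
Proof.
rewrite /walk_weight /w /unit_weight big_const_seq count_predT size_pairmap.
by rewrite iter_addr addr0.
Qed.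

Lemma mst_is_mst (w' : {set T} -> R) G : is_mst w' G (mst w' G).
Proof.
apply: xgetPex.
have [F0 F0P _] := spanning_forest_exists G.
have F0P' : `[< is_spanning_forest G F0 >] by apply/asboolP.
have [F /asboolP FP Fmin] := @arg_minP _ _ _ _
  (fun F => `[< is_spanning_forest G F >]) (weight w') F0P'.
by exists F; split => // F' F'P; apply: Fmin; apply/asboolP.
Qed.

Lemma sparsity_le_lightness G H : (0 < #|edges G|)%N ->
  sparsity R H <= lightness w G H.
Proof.
move=> G0; have [[FG _ FE] Fmin] := mst_is_mst w G.
have [F FP cF] := spanning_forest_exists G.
rewrite /sparsity /lightness weight_unit; apply: ler_wpM2l => //.
(* Division by 0 gives 0, so positivity matters. The ends of an edge of [G] are distinct and stay
   connected in the forest, which therefore has an edge. *)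
have mst_gt0 : 0 < weight w (mst w G).
  rewrite weight_unit ltr0n lt0n cards_eq0; apply/eqP => F0.
  have [e eG] := card_gt0P G0.
  have /eqP/cards2P[x [y [xy eE]]] := card_edge eG.
  have : connect (adj (mst w G)) x y by rewrite FE connect1// /adj -eE.
  case/connectP => -[/= _ yx|z p /= /andP[]]; first by rewrite yx eqxx in xy.
  by rewrite /adj F0 inE.
have le_n : weight w (mst w G) <= #|T|%:R.
  by apply: le_trans (Fmin _ FP) _; rewrite weight_unit ler_nat.
by rewrite lef_pV2 // posrE (lt_le_trans mst_gt0).
Qed.

Lemma girth_gtP m G : (m%:R%:E < girth R G)%E ->
  forall c, is_cycle G c -> (m < size c)%N.
Proof.
move=> mG c cG; rewrite -(ltr_nat R) -lte_fin; apply: lt_le_trans mG _.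
by apply: ereal_inf_lbound; exists c.
Qed.

(* A path of length at most 2k-1 in H between the ends of a missing edge would
   close up to a cycle of length at most 2k. *)
Lemma spanner_of_high_girth k G H : (0 < k)%N ->
  (forall c, is_cycle G c -> (2 * k < size c)%N) ->
  is_spanner (2 * k%:R - 1) w G H -> edges H = edges G.
Proof.
move=> k0 gG [HG dHG]; apply/eqP; rewrite finset.eqEsubset HG /=.
apply/fintype.subsetP => e eG; have /eqP/cards2P[x [y [xy eE]]] := card_edge eG.
rewrite eE; rewrite eE -/(adj G x y) in eG; apply: contraT => xyH.
have dG : (dist w G x y <= 1%:E)%E.
  apply: ereal_inf_lbound; exists [:: y]; first by rewrite /= eG.
  by rewrite walk_weight_unit.
have t0 : 0 <= 2 * k%:R - 1 :> R.
  by rewrite subr_ge0 -natrM ler1n muln_gt0.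
have : (dist w H x y < (2 * k)%:R%:E)%E.
  apply: le_lt_trans (dHG x y) _.
  apply: (@le_lt_trans _ _ ((2 * k%:R - 1)%:E * 1%:E)%E).
    by apply: lee_wpmul2l; rewrite ?lee_fin.
  by rewrite -EFinM mulr1 lte_fin natrM ltrBlDr ltrDl ltr01.
(* The strict bound on the infimum yields an actual walk, which is then shortened to a path without
   repeated vertices. *)
move=> /ereal_inf_lt[_ [p [pH pE] <-]]; rewrite walk_weight_unit lte_fin ltr_nat.
move: pE; case/shortenP: pH => q qH Uq qp qE pk.
have qk : (size q < 2 * k)%N.
  by apply: leq_ltn_trans pk; apply: uniq_leq_size => //; case/andP: Uq.
suff /gG : is_cycle G (x :: q) by rewrite /= ltnS leqNgt qk.
split.
  apply/andP; split => //=; rewrite rcons_path qE adj_sym eG andbT.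
  exact: sub_path (adj_subset HG) _ _ qH.
(* The cycle has at least 3 vertices: [q] is not empty as [x] and [y] differ, and not a single
   vertex as their edge is missing from [H]. *)
case: q qH qE {Uq qp qk} => [|a [|b q]] //=; first by move=> _ E; rewrite E eqxx in xy.
by rewrite andbT => xa E; rewrite -E -/(adj H x a) xa in xyH.
Qed.

End UnitWeight.

(** * Disjoint copies of a graph: cycles and complete minors *)

Section DisjointCopies.
Variables (Q S T : finType) (f : Q -> S -> T) (G0 : graph S).
Hypothesis f_inj : forall q q' a a', f q a = f q' a' -> q = q' /\ a = a'.

Let fq_inj q : injective (f q).
Proof. by move=> a b /f_inj[]. Qed.

(** The images of the maps [f q] need not cover [T]; the vertices left over are isolated. *)
Definition copies_edges : {set {set T}} :=
  [set (f qe.1 @: qe.2)%SET | qe : Q * {set S} in finset.setX [set: Q]%SET (edges G0)].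

Lemma copies_subproof : [forall e in copies_edges, #|e| == 2%N].
Proof.
apply/forall_inP => e /imsetP[[q e0]]; rewrite !inE /= => e0G ->.
by rewrite card_imset ?(card_edge e0G).
Qed.

Definition copies : graph T := Graph copies_subproof.

Lemma card_copies : #|edges copies| = (#|Q| * #|edges G0|)%N.
Proof.
rewrite card_in_imset ?cardsX ?cardsT // => -[q e] [q' e'].
rewrite !inE /= => eG e'G E.
have /card_gt0P[a ae] : (0 < #|e|)%N by rewrite (card_edge eG).
have : f q a \in (f q' @: e')%SET by rewrite -E imset_f.
case/imsetP => b _ /f_inj[qq' _]; rewrite qq' in E *.
by congr pair; apply: imset_inj E.
Qed.

Lemma adj_copiesP x y :
  reflect (exists q a b, [/\ x = f q a, y = f q b & adj G0 a b])
          (adj copies x y).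
Proof.
apply: (iffP imsetP) => [[[q e]]|[q [a [b [-> -> ab]]]]].
  rewrite !inE /= => eG E; have /eqP/cards2P[a [b [_ eE]]] := card_edge eG.
  rewrite eE imsetU1 imset_set1 in E; rewrite eE in eG.
  case: (set2_eqP E) => -[-> ->]; first by exists q, a, b.
  by exists q, b, a; rewrite adj_sym.
by exists (q, [set a; b]%SET); rewrite ?inE //= imsetU1 imset_set1.
Qed.

(** A walk never leaves the copy in which it starts, so the cycle pulls back along one injection
    [f q]. *)
Lemma cycle_copies c : is_cycle copies c ->
  exists2 c0, is_cycle G0 c0 & size c0 = size c.
Proof.
case: c => [|x p] [/andP[/= pG Up] //= p2].
have [q [a xE]] : exists q a, x = f q a.
  by case: p pG {Up p2} => [|y p] /= /andP[/adj_copiesP[q [a [b [-> _ _]]]] _];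
    exists q, a.
have pathP b s : path (adj copies) (f q b) s ->
    exists2 s0, s = map (f q) s0 & path (adj G0) b s0.
  elim: s b => [|y s IH] b /=; first by exists [::].
  case/andP => /adj_copiesP[q' [a' [b' [/f_inj[<- <-] -> ab]]]] /IH[s0 -> bs].
  by exists (b' :: s0); rewrite //= ab.
rewrite xE in pG Up; have [s0 pE sG] := pathP _ _ pG.
case/lastP: s0 pE sG => [|s0 b]; first by case: p {pG Up p2}.
rewrite map_rcons => /rcons_inj[pE /f_inj[_ <-]] sG.
exists (a :: s0); last by rewrite pE /= size_map.
split; last by rewrite /= -(size_map (f q)) -pE.
apply/andP; split => //.
by rewrite pE mem_map // map_inj_uniq in Up.
Qed.

(* A K_h minor with h >= 2 lies in a single copy, and distinct edges of K_h
   come from distinct edges of that copy. *)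
Lemma copies_K_minor_free h : (1 < h)%N -> (#|edges G0| < 'C(h, 2))%N ->
  K_minor_free h copies.
Proof.
move=> h1 ltG [B [B0 Bconn Bdisj Badj]].
(* The index of the copy containing [x], or [None] outside all copies; it is constant along edges,
   hence on the union of the branch sets. *)
pose lab x := [pick q | [exists a, x == f q a]].
have labE q a : lab (f q a) = Some q.
  rewrite /lab; case: pickP => [q' /existsP[a' /eqP/f_inj[-> //]]|/(_ q)].
  by move/negbT/negP; case; apply/existsP; exists a.
have Kadj s s' : s != s' -> adj (complete h) s s'.
  by move=> ss'; rewrite /adj inE cards2 ss'.
have lab_adj x y : adj copies x y -> lab x = lab y.
  by move=> /adj_copiesP[q [a [b [-> -> _]]]]; rewrite !labE.
have lab_conn s x y : x \in B s -> y \in B s -> lab x = lab y.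
  move=> xB yB; have /connectP[p] := Bconn s x y xB yB.
  elim: p x {xB} => [x _ -> //|z p IH x /= /andP[/and3P[_ _ xz] zp] E].
  by rewrite (lab_adj _ _ xz) (IH z).
have lab_all s s' x y : x \in B s -> y \in B s' -> lab x = lab y.
  have [<-|ss'] := eqVneq s s'; first exact: lab_conn.
  move=> xB yB; have [x' [y' [x'B y'B xy]]] := Badj _ _ (Kadj _ _ ss').
  by rewrite (lab_conn s _ x' xB x'B) (lab_adj _ _ xy) (lab_conn s' _ y y'B yB).
pose s0 : 'I_h := Ordinal (ltnW h1); pose s1 : 'I_h := Ordinal h1.
have s01 : s0 != s1 by [].
have [x0 [y0 [x0B _ /adj_copiesP[q [a0 [b0 [x0E _ _]]]]]]] :=
  Badj s0 s1 (Kadj _ _ s01).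
(* The indices of the branch sets that [e] meets. Every edge of K_h is the trace of an edge of copy
   [q], which gives the count. *)
pose trace (e : {set T}) := [set s | [exists x in e, x \in B s]]%SET.
have Bin s s' x : x \in B s -> (x \in B s') = (s == s').
  move=> xB; have [<- //|ss'] := eqVneq s s'; apply: negbTE; apply/negP => xB'.
  by have := Bdisj _ _ ss' => /setP/(_ x); rewrite !inE xB xB'.
have : edges (complete h) \subset
    [set trace (f q @: e)%SET | e : {set S} in edges G0]%SET.
  apply/fintype.subsetP => E /[dup] EK /card_edge/eqP/cards2P[s [s' [ss' EE]]].
  have [x [y [xB yB /adj_copiesP[q' [a [b [xE yE ab]]]]]]] := Badj _ _ (Kadj _ _ ss').
  have qq' : q' = q.
    by have := lab_all _ _ _ _ xB x0B; rewrite xE x0E !labE => -[].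
  apply/imsetP; exists [set a; b]%SET => //.
  rewrite imsetU1 imset_set1 -qq' -xE -yE EE; apply/setP => t.
  rewrite !inE; apply/idP/existsP => [/orP[]/eqP ->|[z]].
  - by exists x; rewrite !inE eqxx.
  - by exists y; rewrite !inE eqxx orbT.
  - rewrite !inE => /andP[/orP[]/eqP ->].
      by rewrite (Bin _ _ _ xB) eq_sym => ->.
    by rewrite (Bin _ _ _ yB) eq_sym orbC => ->.
move/subset_leq_card; rewrite card_draws card_ord => /leq_trans/(_ (leq_imset_card _ _)).
by rewrite leqNgt ltG.
Qed.

End DisjointCopies.

(** * Packing copies into [n] vertices and choosing the parameters *)

Lemma subgraph_card (T : finType) (G : graph T) e : (e <= #|edges G|)%N ->
  exists2 F : graph T, edges F \subset edges G & #|edges F| = e.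
Proof.
move=> eG; have [A [AG cA]] : exists A : {set {set T}}, A \subset edges G /\ #|A| = e.
  have /card_gt0P[A] : (0 < #|[set A : {set {set T}} | A \subset edges G & #|A| == e]|)%N.
    by rewrite cards_draws bin_gt0.
  by rewrite inE => /andP[AG /eqP cA]; exists A.
exists (restrict G A); first exact: finset.subsetIl.
by rewrite /= (finset.setIidPr AG).
Qed.

Lemma block_subproof m n (q : 'I_(n %/ m)) (a : 'I_m) : (q * m + a < n)%N.
Proof.
apply: (@leq_trans (q.+1 * m)); first by rewrite mulSn addnC ltn_add2r.
by apply: leq_trans (leq_trunc_div n m); rewrite leq_mul2r ltn_ord orbT.
Qed.

Definition block m n (q : 'I_(n %/ m)) (a : 'I_m) : 'I_n :=
  Ordinal (block_subproof q a).

Lemma block_inj m n (q q' : 'I_(n %/ m)) (a a' : 'I_m) :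
  block q a = block q' a' -> q = q' /\ a = a'.
Proof.
move=> [E]; have m0 : (0 < m)%N by apply: leq_ltn_trans (ltn_ord a).
split; apply: val_inj => /=.
  have := congr1 (divn^~ m) E; rewrite !divnMDl //.
  by rewrite (divn_small (ltn_ord a)) (divn_small (ltn_ord a')) !addn0.
by have := congr1 (modn^~ m) E; rewrite !modnMDl !modn_small.
Qed.

(** The factor 1/2 pays for the fewer than [m] vertices outside the blocks: since [m <= n], at least
    half of the vertices are covered. *)
Lemma spanner_lower_bound (R : realType) k h m (G0 : graph 'I_m) :
  (0 < k)%N -> (1 < h)%N ->
  (forall c, is_cycle G0 c -> (2 * k < size c)%N) ->
  (0 < #|edges G0| < 'C(h, 2))%N ->
  forall n, (m <= n)%N -> exists G : graph 'I_n, K_minor_free h G /\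
    forall H, is_spanner (2 * k%:R - 1) (@unit_weight R 'I_n) G H ->
      #|edges G0|%:R / m%:R / 2 <= sparsity R H /\
      #|edges G0|%:R / m%:R / 2 <= lightness (@unit_weight R 'I_n) G H.
Proof.
move=> k0 h1 gG0 /andP[G00 G0h] n mn.
have m0 : (0 < m)%N.
  have /card_gt0P[e /card_edge e2] := G00.
  by have := max_card (mem e); rewrite card_ord e2; apply: leq_trans.
pose G := copies G0 (@block_inj m n).
have q0 : (0 < n %/ m)%N by rewrite divn_gt0.
have cG : #|edges G| = (n %/ m * #|edges G0|)%N by rewrite card_copies card_ord.
exists G; split; first exact: copies_K_minor_free.
move=> H HG.
have gG c : is_cycle G c -> (2 * k < size c)%N.
  by move=> /cycle_copies[c0 /gG0 + <-].
have HE := spanner_of_high_girth k0 gG HG.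
have sp : #|edges G0|%:R / m%:R / 2 <= sparsity R H.
  rewrite /sparsity HE cG card_ord natrM ler_pdivlMr ?ltr0n ?(leq_trans m0) //.
  have n2 : n%:R <= 2 * ((n %/ m)%:R * m%:R) :> R.
    rewrite -!natrM ler_nat mul2n -addnn {1}(divn_eq n m) leq_add2l.
    by rewrite (leq_trans (ltnW (ltn_pmod n m0))) // leq_pmull.
  apply: (@le_trans _ _ (#|edges G0|%:R / m%:R / 2 *
                           (2 * ((n %/ m)%:R * m%:R)))).
    by apply: ler_wpM2l n2; rewrite !divr_ge0.
  suff -> : #|edges G0|%:R / m%:R / 2 * (2 * ((n %/ m)%:R * m%:R)) =
            (n %/ m)%:R * #|edges G0|%:R :> R by [].
  by field; rewrite pnatr_eq0 -lt0n.
split => //; apply: le_trans sp _; apply: sparsity_le_lightness.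
by rewrite cG muln_gt0 q0.
Qed.

(** The constant 2/9 gives equality at [h = 3]. *)
Lemma bin2_pred_ge (R : realType) h : (3 <= h)%N ->
  2 / 9 * h%:R ^+ 2 <= ('C(h, 2).-1)%:R :> R.
Proof.
move=> h3; have h3R : 3 <= h%:R :> R by rewrite ler_nat.
have b0 : (0 < 'C(h, 2))%N by rewrite bin_gt0 ltnW.
have b2 : 2 * 'C(h, 2)%:R = h%:R * (h%:R - 1) :> R.
  rewrite -natrM -mul_bin_diag bin1 natrM; congr (_ * _).
  by rewrite -[in RHS](ltn_predK h3) -natr1 addrK.
have -> : ('C(h, 2).-1)%:R = 'C(h, 2)%:R - 1 :> R.
  by rewrite -[in RHS](prednK b0) -natr1 addrK.
nra.
Qed.

(** The constant is chosen before [h]. For [h] at most 2, a K_h-minor-free graph has no edges and a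
    positive bound fails, hence [3 <= h]. *)
Theorem theorem7 (R : realType) (girth_conj : erdos_girth_conjecture R) :
  forall k : nat, (0 < k)%N ->
  exists2 c : R, 0 < c &
  forall h : nat, (3 <= h)%N ->
  exists n0 : nat, forall n : nat, (n0 <= n)%N ->
  exists G : graph 'I_n,
    K_minor_free h G /\
    forall H : graph 'I_n,
      is_spanner (2 * k%:R - 1) (@unit_weight R 'I_n) G H ->
      c * h%:R `^ (2 / (k%:R + 1)) <= sparsity R H /\
      c * h%:R `^ (2 / (k%:R + 1)) <= lightness (@unit_weight R 'I_n) G H.
Proof.
move=> k k0; have [c1 c10 [n0 conj]] := girth_conj k k0.
(* [c1] serves when all edges of the high-girth graph are kept, 2/9 when they are cut down to
   ['C(h, 2).-1]. *)
pose c2 : R := Num.min c1 (2 / 9).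
have c20 : 0 < c2 by rewrite lt_min c10 divr_gt0.
have k0R : 0 < k%:R :> R by rewrite ltr0n.
exists (c2 / (n0%:R + 2) / 2); first by rewrite !divr_gt0 // ltr_wpDl.
move=> h h3; have h1 : 1 <= h%:R :> R by rewrite ler1n (leq_trans _ h3).
have h0 : 0 < h%:R :> R by rewrite (lt_le_trans ltr01).
(* Chosen so that [x `^ (1 + 1 / k)] is h^2, the order of 'C(h, 2). *)
pose x : R := h%:R `^ (2 * k%:R / (k%:R + 1)).
have x1 : 1 <= x.
  by rewrite -[leLHS](powRr0 h%:R); apply: ler_powR.
have xk : x `^ (1 + 1 / k%:R) = h%:R ^+ 2.
  rewrite /x -powRrM -powR_mulrn ?ler0n //; congr (_ `^ _).
  by field; rewrite !gt_eqF // ltr_wpDl.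
have xh : x * h%:R `^ (2 / (k%:R + 1)) = h%:R ^+ 2.
  rewrite /x -powRD; last by rewrite (gt_eqF h0) implybT.
  rewrite -powR_mulrn ?ler0n //; congr (_ `^ _).
  by field; rewrite gt_eqF // ltr_wpDl.
(* Large enough for the conjecture and at least [x], yet at most [(n0 + 2) * x] because [1 <= x];
   this ratio is the loss in the final constant. *)
pose m := (n0 + Num.trunc x).+1.
have xm : x <= m%:R.
  apply: le_trans (ltW (truncnS_gt x)) _.
  by rewrite ler_nat ltnS leq_addl.
have mx : m%:R <= (n0%:R + 2) * x.
  have /andP[tx _] := truncn_itv (le_trans ler01 x1).
  have n00 : 0 <= n0%:R :> R by [].
  rewrite /m -natr1 natrD; nra.
have [|G1 [gG1 cG1]] := conj m isT; first by rewrite ltnW // ltnS leq_addr.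
pose e := minn #|edges G1| 'C(h, 2).-1.
have [G0 G01 cG0] := @subgraph_card _ G1 e (geq_minl _ _).
have eh : c2 * h%:R ^+ 2 <= e%:R.
  rewrite /e /minn; case: ifP => _.
    apply: le_trans cG1; apply: ler_pM => //; first exact: ltW.
      by rewrite ge_min lexx.
    by rewrite -xk; apply: ge0_ler_powR; rewrite ?nnegrE ?addr_ge0 ?divr_ge0 //
      (le_trans ler01 x1).
  apply: le_trans (bin2_pred_ge R h3); apply: ler_wpM2r => //.
  by rewrite ge_min lexx orbT.
have e0 : (0 < e)%N.
  by rewrite -(ltr0n R); apply: lt_le_trans eh; rewrite mulr_gt0 ?exprn_gt0.
have eC : (e < 'C(h, 2))%N.
  apply: leq_ltn_trans (geq_minr _ _) _.
  by rewrite prednK // bin_gt0 ltnW.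
have gG0 c : is_cycle G0 c -> (2 * k < size c)%N.
  by move/(is_cycle_subset G01); apply: girth_gtP gG1 c.
exists m => n mn.
have := @spanner_lower_bound R k h m G0 k0 (ltnW h3) gG0.
rewrite cG0 e0 eC => /(_ isT n mn)[G [Gfree GH]].
exists G; split => // H /GH[Hs Hl].
suff le : c2 / (n0%:R + 2) / 2 * h%:R `^ (2 / (k%:R + 1)) <= e%:R / m%:R / 2.
  by split; apply: le_trans le _.
have n02 : 0 < n0%:R + 2 :> R by rewrite ltr_wpDl.
rewrite [leLHS]mulrAC ler_pM2r ?invr_gt0 // ler_pdivlMr ?ltr0n //.
apply: le_trans eh; rewrite -xh.
set z := _ `^ _; have z0 : 0 <= z by apply: powR_ge0.
apply: (@le_trans _ _ (c2 / (n0%:R + 2) * z * ((n0%:R + 2) * x))).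
  by apply: ler_wpM2l mx; rewrite mulr_ge0 // divr_ge0 // ltW.
suff -> : c2 / (n0%:R + 2) * z * ((n0%:R + 2) * x) = c2 * (x * z) by [].
by field; rewrite gt_eqF.
Qed.
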